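(* Let $\Sigma$ be a signed graph and $v$ a vertex of $\Sigma$ such that every block of $\Sigma$ containing $v$ contains a circle, and let $C$ be a circle containing $v$. Then $[v,C,-]$ is a negative vertex battery (i.e. $C$ is negative and is the only negative circle of $\Sigma$ containing $v$) if and only if: (1) the block $B$ of $\Sigma$ containing $C$ is the only unbalanced block of $\Sigma$ containing $v$, and $\deg_B(v)=2$; and (2) $[e_v, C{\downarrow}v, -]$ is a negative edge battery in $B{\downarrow}v$, i.e. $C{\downarrow}v$ is the only negative circle of $B{\downarrow}v$ containing $e_v$.
   Context: A signed graph $\Sigma=(G,\sigma)$ is a finite graph $G$ with signature $\sigma:E(G)\to\{+,-\}$. A circle is a connected 2-regular subgraph; its sign is the product of its edge signs. A subgraph is balanced if all its circles are positive, unbalanced otherwise. A block is a maximal subgraph without a cutpoint; $\deg_B(v)$ is the number of edges of $B$ incident with $v$. If $\deg_B(v)=2$ with incident edges $vv_1,vv_2$ in $B$, suppressing $v$ means deleting $v$ and these two edges and adding a new edge $e_v$ joining $v_1$ and $v_2$ with sign $\sigma(vv_1)\sigma(vv_2)$; the result is the signed graph $B{\downarrow}v$, and for a circle $C$ of $B$ through $v$, $C{\downarrow}v$ is the corresponding circle of $B{\downarrow}v$ through $e_v$.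
   Formalization: The circle C is assumed not to be a loop: for a single negative loop at v, C is the only negative circle containing v, but B has no two edges at v, so condition (1) fails or the suppression B↓v is undefined. *)

(* Defs.v *)
From HB Require Import structures.
From mathcomp Require Import all_boot all_order all_algebra.
Set Implicit Arguments. Unset Strict Implicit. Unset Printing Implicit Defensive.
Import GRing.Theory.

(* A signed graph is given by finite types V (vertices) and E (edges),
   an endpoint map  ends : E -> V * V  (unordered reading; ends e = (x,x) is a
   loop), and a signature  sigma : E -> bool  with  sigma e = true  meaning
   σ(e) = +  and  sigma e = false  meaning  σ(e) = - .
   A subgraph is a pair (W, F) of a vertex set and an edge set with all
   endpoints of edges of F in W. *)

Section SignedGraph.
Variables (V E : finType) (ends : E -> V * V) (sigma : E -> bool).

Definition incident (x : V) (e : E) : bool := ((ends e).1 == x) || ((ends e).2 == x).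

Definition deg (F : {set E}) (x : V) : nat :=
  \sum_(e in F) (((ends e).1 == x) + ((ends e).2 == x))%N.

Definition verts (F : {set E}) : {set V} := [set x | [exists e in F, incident x e]].

Definition wf_sub (W : {set V}) (F : {set E}) : Prop :=
  forall e, e \in F -> ((ends e).1 \in W) /\ ((ends e).2 \in W).

Definition adj (F : {set E}) : rel V :=
  fun x y => [exists e in F, (ends e == (x, y)) || (ends e == (y, x))].

Definition connected_sub (W : {set V}) (F : {set E}) : Prop :=
  W != set0 /\ forall x y, x \in W -> y \in W -> connect (adj F) x y.

Definition cutpoint (W : {set V}) (F : {set E}) (w : V) : Prop :=
  exists (W1 W2 : {set V}) (F1 F2 : {set E}),
    [/\ wf_sub W1 F1 /\ wf_sub W2 F2, W1 :|: W2 = W, F1 :|: F2 = F,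
        [disjoint F1 & F2] /\ W1 :&: W2 = [set w] & (F1 != set0) && (F2 != set0)].

Definition nocut (W : {set V}) (F : {set E}) : Prop := forall w, ~ cutpoint W F w.

Definition block (W : {set V}) (F : {set E}) : Prop :=
  [/\ wf_sub W F, connected_sub W F, nocut W F &
      forall W' F', wf_sub W' F' -> connected_sub W' F' -> nocut W' F' ->
        W \subset W' -> F \subset F' -> W' = W /\ F' = F].

Definition circle (C : {set E}) : Prop :=
  [/\ C != set0, connected_sub (verts C) C & forall x, x \in verts C -> deg C x = 2%N].

Definition csign (C : {set E}) : int := (\prod_(e in C) (if sigma e then 1 else -1))%R.

Definition negative (C : {set E}) : Prop := csign C = (-1)%R.

Definition unbalanced (F : {set E}) : Prop :=
  exists D, [/\ circle D, D \subset F & negative D].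

Definition neg_vertex_battery (v : V) (C : {set E}) : Prop :=
  [/\ circle C, v \in verts C, negative C &
      forall D, circle D -> v \in verts D -> negative D -> D = C].

Definition neg_edge_battery (F : {set E}) (e : E) (C : {set E}) : Prop :=
  [/\ circle C, C \subset F, e \in C, negative C &
      forall D, circle D -> D \subset F -> e \in D -> negative D -> D = C].

(* Suppression of v, whose two incident edges are e1, e2.
   Edges of the new graph live in option E: Some e is the old edge e and
   None is the new edge e_v. *)
Definition other (x : V) (e : E) : V := if (ends e).1 == x then (ends e).2 else (ends e).1.

Definition sup_ends (v : V) (e1 e2 : E) (o : option E) : V * V :=
  if o is Some e then ends e else (other v e1, other v e2).

(* sign of e_v is σ(e1)σ(e2) *)
Definition sup_sigma (e1 e2 : E) (o : option E) : bool :=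
  if o is Some e then sigma e else sigma e1 == sigma e2.

Definition sup_verts (W : {set V}) (v : V) : {set V} := W :\ v.

Definition sup_edges (F : {set E}) (e1 e2 : E) : {set option E} :=
  None |: (Some @: (F :\: [set e1; e2])).

End SignedGraph.

(* Main.v *)
Require Import Defs.
From HB Require Import structures.
From mathcomp Require Import all_boot all_order all_algebra.
From mathcomp Require Import zify.
From Stdlib Require Import Classical_Prop.
Set Implicit Arguments. Unset Strict Implicit. Unset Printing Implicit Defensive.
Import GRing.Theory.

(* The key fact is that in an unbalanced block every edge f lies on a negative
   circle.  Call a vertex set U "two-signed" if any two distinct vertices of U
   are joined by both a positive and a negative path inside U.  The vertex set
   of a negative circle is two-signed, and adding an ear to a two-signed set
   keeps it so: two vertices of the ear are also joined by going out to the ends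
   of the ear and through U, with either sign.  As the block has no cutpoint,
   ears can be added until U is the whole block; then a path of
   sign -sigma(f) between the ends of f closes with f to a negative circle.
   Hence if C is the only negative circle at v, then v lies in no other
   unbalanced block (blocks sharing an edge coincide) and no edge of B outside C
   meets v, so deg_B(v) = 2.  When deg_B(v) = 2, every circle of B at v uses both
   edges at v, and suppression is a sign-preserving bijection from these circles
   to the circles of the suppressed graph through e_v. *)

(** * Degrees, the handshake lemma, and circles as edge sets *)

Section Degrees.
Variables (V E : finType) (ends : E -> V * V).
Implicit Types (F P D : {set E}) (x y v : V) (e : E).

Definition joins e x y : bool := (ends e == (x, y)) || (ends e == (y, x)).

Lemma joinsC e x y : joins e x y = joins e y x.
Proof. by rewrite /joins orbC. Qed.

Lemma joins_ends e : joins e (ends e).1 (ends e).2.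
Proof. by rewrite /joins -surjective_pairing eqxx. Qed.

Lemma joinsP e x y :
  reflect (((ends e).1 = x /\ (ends e).2 = y) \/ ((ends e).1 = y /\ (ends e).2 = x))
          (joins e x y).
Proof.
rewrite /joins; case: (ends e) => a b /=; apply: (iffP orP).
  by case=> /eqP[-> ->]; [left|right].
by case=> -[-> ->]; [left|right].
Qed.

Lemma adjP F x y : reflect (exists2 e, e \in F & joins e x y) (adj ends F x y).
Proof. exact: exists_inP. Qed.

Lemma adj_sym F : symmetric (adj ends F).
Proof.
move=> x y; apply/adjP/adjP => -[e eF j]; exists e => //; by rewrite joinsC.
Qed.

Lemma joins_incident e x y : joins e x y -> incident ends x e.
Proof. by rewrite /incident; case/joinsP=> -[-> ->]; rewrite eqxx ?orbT. Qed.

Lemma incident_joins e x : incident ends x e -> joins e x (other ends x e).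
Proof.
rewrite /incident /other; case: eqP => [<- _|_ /= /eqP <-]; first exact: joins_ends.
by rewrite joinsC joins_ends.
Qed.

Lemma joins_other e x y : joins e x y -> other ends x e = y.
Proof.
rewrite /other; case/joinsP => -[-> ->]; first by rewrite eqxx.
by case: eqP.
Qed.

Definition inc e x : nat := ((ends e).1 == x) + ((ends e).2 == x).

Lemma degE F x : deg ends F x = \sum_(e in F) inc e x.
Proof. by []. Qed.

Lemma joins_inc e x y z : joins e x y -> inc e z = ((z == x) + (z == y))%N.
Proof.
by rewrite /inc; case/joinsP=> -[-> ->]; rewrite ![_ == z]eq_sym // addnC.
Qed.

Lemma inc_gt0 e x : (0 < inc e x)%N = incident ends x e.
Proof. by rewrite /inc /incident addn_gt0 !lt0b. Qed.

Lemma deg0 x : deg ends set0 x = 0%N.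
Proof. by rewrite degE big_set0. Qed.

Lemma deg_setU1 e F x : e \notin F -> deg ends (e |: F) x = (inc e x + deg ends F x)%N.
Proof. by move=> eF; rewrite !degE big_setU1. Qed.

Lemma deg_setD1 e F x : e \in F -> deg ends F x = (inc e x + deg ends (F :\ e) x)%N.
Proof. by move=> eF; rewrite -{1}(setD1K eF) deg_setU1 // !inE eqxx. Qed.

Lemma deg_subD D F x : D \subset F ->
  deg ends F x = (deg ends D x + deg ends (F :\: D) x)%N.
Proof.
by move=> DF; rewrite !degE (big_setID D) /= (setIidPr DF).
Qed.

Lemma deg_sub D F x : D \subset F -> (deg ends D x <= deg ends F x)%N.
Proof. by move=> DF; rewrite (deg_subD x DF) leq_addr. Qed.

Lemma deg_eq0 F x : deg ends F x = 0%N -> forall e, e \in F -> ~~ incident ends x e.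
Proof.
move=> d0 e eF; rewrite -inc_gt0 -leqNgt; move: d0; rewrite (deg_setD1 x eF).
by case: inc.
Qed.

Lemma deg_gt0 F x e : e \in F -> incident ends x e -> (0 < deg ends F x)%N.
Proof. by move=> eF i; rewrite (deg_setD1 x eF) addn_gt0 inc_gt0 i. Qed.

Lemma vertsP F x : reflect (exists2 e, e \in F & incident ends x e) (x \in verts ends F).
Proof. rewrite inE; exact: exists_inP. Qed.

Lemma verts_deg F x : (x \in verts ends F) = (0 < deg ends F x)%N.
Proof.
apply/vertsP/idP => [[e]|]; first exact: deg_gt0.
case: (pickP [pred e in F | incident ends x e]) => [e /andP[]|no]; first by exists e.
rewrite degE big1 // => e eF; move: (no e); rewrite /= eF /= -inc_gt0.
by case: inc.
Qed.

Lemma deg_other_edge F x e : e \in F -> (inc e x < deg ends F x)%N ->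
  exists2 f, f \in F :\ e & incident ends x f.
Proof.
move=> eF; rewrite (deg_setD1 x eF) -[X in (X < _)%N]addn0 ltn_add2l -verts_deg.
by move/vertsP.
Qed.

(* Handshake lemma, localised to a union [K] of connected components of [F]. *)
Lemma handshake F (K : {set V}) :
  (forall e, e \in F -> ((ends e).1 \in K) = ((ends e).2 \in K)) ->
  ~~ odd (\sum_(x in K) deg ends F x).
Proof.
move=> cl.
have cnt (z : V) : \sum_(x in K) (z == x : nat) = (z \in K).
  case: (boolP (z \in K)) => zK.
    rewrite (bigD1 z) //= eqxx big1 ?addn0 // => x /andP[_].
    by rewrite eq_sym => /negbTE->.
  by rewrite big1 // => x xK; case: eqP zK => // ->; rewrite xK.
under eq_bigr do rewrite degE.
(* Counted edge by edge, every contribution is 0 or 2, since both ends of an edge lie in [K] or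
   neither does. *)
rewrite exchange_big /=; elim/big_ind: _ => // [m n|e eF].
  by rewrite oddD => /negbTE-> /negbTE->.
by rewrite big_split /= !cnt cl // oddD addbb.
Qed.

Lemma deg2_edges F x e1 e2 : deg ends F x = 2%N -> e1 != e2 -> e1 \in F -> e2 \in F ->
  incident ends x e1 -> incident ends x e2 ->
  [/\ inc e1 x = 1%N, inc e2 x = 1%N & deg ends (F :\: [set e1; e2]) x = 0%N].
Proof.
move=> d ne e1F e2F i1 i2.
have e2F' : e2 \in F :\ e1 by rewrite !inE eq_sym ne.
move: d; rewrite (deg_setD1 x e1F) (deg_setD1 x e2F') -setDDl.
by move: i1 i2; rewrite -!inc_gt0 => i1 i2 d; split; lia.
Qed.

Lemma circle_nonempty D : circle ends D -> exists e, e \in D.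
Proof. by case=> /set0Pn. Qed.

Lemma circle_connect D x y : circle ends D -> x \in verts ends D -> y \in verts ends D ->
  connect (adj ends D) x y.
Proof. by case=> _ [_ c] _; exact: c. Qed.

Lemma circle_deg D x : circle ends D -> x \in verts ends D -> deg ends D x = 2%N.
Proof. by case=> _ _; exact. Qed.

Lemma adj_connect_closed F (K : {set V}) x y :
  (forall e, e \in F -> ((ends e).1 \in K) = ((ends e).2 \in K)) ->
  x \in K -> connect (adj ends F) x y -> y \in K.
Proof.
move=> cl xK /connectP[p pp ->]; elim: p x xK pp => //= z p IH x xK /andP[/adjP[e eF j] pp].
apply: IH pp; move: (cl e eF) xK; by case/joinsP: j => -[-> ->] => [->|<-].
Qed.

Lemma connect_cross F (U : {set V}) x y : x \in U -> y \notin U ->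
  connect (adj ends F) x y ->
  exists a b e, [/\ a \in U, b \notin U, e \in F & joins e a b].
Proof.
move=> xU yU /connectP[p pp yl]; elim: p x xU pp yl => [|z p IH] x xU /=.
  by move=> _ yx; move: yU; rewrite yx xU.
case/andP=> /adjP[e eF j] pp yl.
case: (boolP (z \in U)) => zU; first exact: IH pp yl.
by exists x, z, e.
Qed.

(** [D'] already uses up the degree 2 of [D] at each of its vertices, so no edge of [D] outside [D']
    meets [verts D']. That set is then closed under adjacency in [D], and connectedness of [D]
    leaves no room for further edges. *)
Lemma circle_sub_eq D D' : circle ends D -> circle ends D' -> D' \subset D -> D' = D.
Proof.
move=> cD cD' sub; apply/eqP; rewrite eqEsubset sub /=.
have far x : x \in verts ends D' -> deg ends (D :\: D') x = 0%N.
  move=> xD'; have xD : x \in verts ends D.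
    by rewrite verts_deg (leq_trans _ (deg_sub x sub)) // -verts_deg.
  by have := deg_subD x sub; rewrite (circle_deg cD xD) (circle_deg cD' xD'); lia.
have cl e : e \in D -> ((ends e).1 \in verts ends D') = ((ends e).2 \in verts ends D').
  move=> eD; have [eD'|eD'] := boolP (e \in D').
    have -> : (ends e).1 \in verts ends D'.
      by apply/vertsP; exists e; rewrite ?(joins_incident (joins_ends e)).
    apply/esym/vertsP; exists e => //.
    by apply: (@joins_incident _ _ (ends e).1); rewrite joinsC joins_ends.
  have eDD : e \in D :\: D' by rewrite inE eD'.
  apply/idP/idP => /far/deg_eq0/(_ _ eDD); by rewrite /incident eqxx ?orbT.
have [e0 e0D'] := circle_nonempty cD'.
have x0D' : (ends e0).1 \in verts ends D'.
  by apply/vertsP; exists e0; rewrite ?(joins_incident (joins_ends e0)).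
apply/subsetP=> e eD; apply: contraT => eD'.
have x0D : (ends e0).1 \in verts ends D.
  by apply/vertsP; exists e0; rewrite ?(subsetP sub) ?(joins_incident (joins_ends e0)).
have xD : (ends e).1 \in verts ends D.
  by apply/vertsP; exists e; rewrite ?(joins_incident (joins_ends e)).
have xD' := adj_connect_closed cl x0D' (circle_connect cD x0D xD).
have eDD : e \in D :\: D' by rewrite inE eD'.
by have := deg_eq0 (far _ xD') eDD; rewrite /incident eqxx.
Qed.

(** In a separation at [w], all vertices of [W1] except [w] have degree 2 in [F1], so by the
    handshake lemma [F1] has even degree at [w]. As [D] has degree 2 there, one side misses [w],
    against connectedness. *)
Lemma circle_nocut D : circle ends D -> nocut ends (verts ends D) D.
Proof.
move=> cD w [W1 [W2 [F1 [F2 [[wf1 wf2] WU FU [dis WI] /andP[/set0Pn[e1 e1F] /set0Pn[e2 e2F]]]]]]].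
have sub1 : F1 \subset D by rewrite -FU subsetUl.
have DF1 : D :\: F1 = F2.
  apply/setP=> e; rewrite -FU !inE; case: (boolP (e \in F1)) => //= eF1.
  by apply/esym/negbTE; rewrite (disjointFr dis).
have wW : w \in W1 :&: W2 by rewrite WI set11.
have wD : w \in verts ends D by move: wW; rewrite -WU !inE => /andP[->].
have far (A B : {set V}) FA x : wf_sub ends B FA -> A :&: B = [set w] -> x \in A -> x != w ->
    deg ends FA x = 0%N.
  move=> wf I xA xw; rewrite degE big1 // => e eF; have [h1 h2] := wf e eF.
  have xB : x \notin B by apply: contra xw => xB; rewrite -in_set1 -I inE xA.
  rewrite /inc; case: eqP => [h|_]; first by rewrite h (negbTE xB) in h1.
  by case: eqP => // h; rewrite h (negbTE xB) in h2.
have [w1 w2] : w \in W1 /\ w \in W2 by move: wW; rewrite inE => /andP.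
have d1 x : x \in W1 -> x != w -> deg ends F1 x = 2%N.
  move=> xW xw; have := deg_subD x sub1; rewrite DF1 (far _ _ _ _ wf2 WI xW xw) addn0 => <-.
  by apply: circle_deg cD _; rewrite -WU inE xW.
have := @handshake F1 W1 _; rewrite (bigD1 w) //= oddD.
rewrite (_ : odd (\sum_(i in W1 | i != w) deg ends F1 i) = false); last first.
  apply: negbTE; elim/big_ind: _ => // [m n|x /andP[xW xw]]; last by rewrite d1.
  by rewrite oddD => /negbTE-> /negbTE->.
rewrite addbF => /(_ (fun e eF => etrans (proj1 (wf1 e eF)) (esym (proj2 (wf1 e eF))))) evn.
have dw := deg_subD w sub1; rewrite DF1 (circle_deg cD wD) in dw.
(* If [FA] misses [w], then [A :\ w] is a union of components of [D]. *)
have key (A B : {set V}) FA FB e : wf_sub ends A FA -> wf_sub ends B FB -> A :&: B = [set w] ->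
    FA :|: FB = D -> deg ends FA w = 0%N -> e \in FA -> False.
  move=> wfA wfB I U d0 eF.
  have cl f : f \in D -> ((ends f).1 \in A :\ w) = ((ends f).2 \in A :\ w).
    rewrite -U !inE => /orP[fA|fB].
      have [-> ->] := wfA f fA; rewrite !andbT.
      by have := deg_eq0 d0 fA; rewrite /incident negb_or => /andP[-> ->].
    have [h1 h2] := wfB f fB.
    have out z : z \in B -> ((z != w) && (z \in A)) = false.
      by move=> zB; apply/negP=> /andP[zw zA]; move: zw; rewrite -in_set1 -I inE zA zB.
    by rewrite !out.
  have xA : (ends e).1 \in A :\ w.
    rewrite !inE (proj1 (wfA e eF)) andbT.
    by have := deg_eq0 d0 eF; rewrite /incident negb_or => /andP[].
  have xD : (ends e).1 \in verts ends D.
    apply/vertsP; exists e; last by rewrite (joins_incident (joins_ends e)).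
    by rewrite -U inE eF.
  by have := adj_connect_closed cl xA (circle_connect cD xD wD); rewrite !inE eqxx.
have [d0|d0] := eqVneq (deg ends F1 w) 0%N.
  exact: (key W1 W2 F1 F2 e1).
have d20 : deg ends F2 w = 0%N by move: dw evn d0; lia.
by apply: (key W2 W1 F2 F1 e2) => //; rewrite 1?setIC // setUC.
Qed.

End Degrees.

(** * Signed simple paths and the circles they close *)

Section SignedPaths.
Variables (V E : finType) (ends : E -> V * V) (sigma : E -> bool).
Implicit Types (F P Q D : {set E}) (X Y U W : {set V}) (a b c x y z : V) (e : E) (s : bool).
Local Notation joins := (joins ends).
Local Notation deg := (deg ends).
Local Notation circle := (circle ends).
Local Notation verts := (verts ends).

(* Simple paths in [F] from [a] to [b] with vertex set [X] and edge set [P];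
   the bit is the parity of the number of negative edges. *)
Inductive spath F : {set V} -> {set E} -> bool -> V -> V -> Prop :=
| spath_nil a : spath F [set a] set0 false a a
| spath_cons a b c e X P s : e \in F -> joins e a b -> a \notin X ->
    spath F X P s b c -> spath F (a |: X) (e |: P) (~~ sigma e (+) s) a c.

Lemma spath_inv F X P s a b : spath F X P s a b ->
  [/\ a = b, X = [set a], P = set0 & s = false] \/
  exists c e X' P' s', [/\ e \in F, joins e a c, a \notin X', spath F X' P' s' c b &
    [/\ X = a |: X', P = e |: P' & s = ~~ sigma e (+) s']].
Proof.
case=> [x|x y z e X' P' s' eF j xX p]; first by left.
by right; exists y, e, X', P', s'.
Qed.

Lemma spath_start F X P s a b : spath F X P s a b -> a \in X.
Proof. by case=> [x|x y z e X' P' s' _ _ _ _]; rewrite ?setU11 ?set11. Qed.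

Lemma spath_end F X P s a b : spath F X P s a b -> b \in X.
Proof. by elim=> [x|x y z e X' P' s' _ _ _ _ zX]; rewrite !inE ?zX ?eqxx ?orbT. Qed.

Lemma spath_sub F X P s a b : spath F X P s a b -> P \subset F.
Proof.
elim=> [x|x y z e X' P' s' eF _ _ _ IH]; first exact: sub0set.
by rewrite subUset sub1set eF.
Qed.

Lemma spath_restrict F F' X P s a b :
  spath F X P s a b -> P \subset F' -> spath F' X P s a b.
Proof.
elim=> [x|x y z e X' P' s' eF j xX _ IH]; first by constructor.
by rewrite subUset sub1set => /andP[eF' /IH]; exact: spath_cons.
Qed.

Lemma spath_widen F F' X P s a b : F \subset F' -> spath F X P s a b -> spath F' X P s a b.
Proof. by move=> FF' p; apply: (spath_restrict p); apply: subset_trans (spath_sub p) FF'. Qed.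

Lemma spath_ends_in F X P s a b e : spath F X P s a b -> e \in P ->
  (ends e).1 \in X /\ (ends e).2 \in X.
Proof.
elim=> [x|x y z f X' P' s' fF j xX p IH]; first by rewrite in_set0.
rewrite in_setU1 => /predU1P[->|/IH[h1 h2]]; last by rewrite !inE h1 h2 !orbT.
have yX := spath_start p.
by case/joinsP: j => -[-> ->]; rewrite !inE eqxx yX ?orbT.
Qed.

Lemma spath_new_edge F X P s a b x y e : spath F X P s a b -> x \notin X -> joins e x y ->
  e \notin P.
Proof.
move=> p xX j; apply: contra xX => /(spath_ends_in p)[h1 h2].
by case/joinsP: j => -[] => [<- _|_ <-].
Qed.

(** The two end terms make the formula valid for the trivial path as well, and they are exactly what
    an edge joining [a] and [b] contributes when it closes the path to a circle. *)
Lemma spath_deg F X P s a b x : spath F X P s a b ->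
  (deg P x + ((x == a) + (x == b)) = (x \in X).*2)%N.
Proof.
elim=> [y|c y z e X' P' s' eF j cX p IH].
  by rewrite deg0 in_set1 addnn.
rewrite deg_setU1 ?(spath_new_edge p cX j) // (joins_inc _ j) in_setU1.
move: IH; have [->|] := eqVneq x c; last by lia.
by rewrite (negbTE cX); lia.
Qed.

Lemma spath_connect F X P s a b x : spath F X P s a b -> x \in X -> connect (adj ends P) a x.
Proof.
elim=> [y|c y z e X' P' s' eF j cX p IH].
  by rewrite in_set1 => /eqP->; exact: connect0.
rewrite in_setU1 => /predU1P[->|/IH cn]; first exact: connect0.
apply: (connect_trans (y := y)).
  by apply/connect1/adjP; exists e; rewrite ?setU11.
apply: connect_sub cn => u w /adjP[f fP jf]; apply/connect1/adjP.
by exists f; rewrite ?in_setU1 ?fP ?orbT.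
Qed.

Lemma spath_loop F X P s a : spath F X P s a a -> [/\ X = [set a], P = set0 & s = false].
Proof.
case/spath_inv => [[//]|[c [e [X' [P' [s' [_ _ aX p]]]]]]].
by rewrite (spath_end p) in aX.
Qed.

Lemma csign_setU1 e P s : e \notin P -> csign sigma P = ((-1) ^+ s)%R ->
  csign sigma (e |: P) = ((-1) ^+ (~~ sigma e (+) s))%R.
Proof.
move=> eP; rewrite /csign big_setU1 //= => ->; rewrite signr_addb.
by case: (sigma e); rewrite ?expr0 ?expr1.
Qed.

Lemma spath_csign F X P s a b : spath F X P s a b -> csign sigma P = ((-1) ^+ s)%R.
Proof.
elim=> [x|x y z e X' P' s' eF j xX p IH]; first by rewrite /csign big_set0.
by apply: csign_setU1 IH; apply: spath_new_edge p xX j.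
Qed.

Lemma negative_setU1 F X P s a b e : spath F X P s a b -> e \notin P ->
  negative sigma (e |: P) <-> ~~ sigma e (+) s.
Proof.
move=> p eP; rewrite /negative (csign_setU1 eP (spath_csign p)).
by case: (_ (+) _).
Qed.

Lemma spath_cat F X P s Y Q t a b c : spath F X P s a b -> spath F Y Q t b c ->
  X :&: Y = [set b] -> spath F (X :|: Y) (P :|: Q) (s (+) t) a c.
Proof.
elim=> [x|x y z e X' P' s' eF j xX p IH] q I.
  by rewrite set0U (setUidPr _) // sub1set (spath_start q).
have zX := spath_end p.
have I' : X' :&: Y = [set z].
  apply/eqP; rewrite eqEsubset -{1}I setSI ?subsetUr //= sub1set inE zX.
  by rewrite (spath_start q).
rewrite -!setUA -addbA; apply: (spath_cons eF j _ (IH q I')).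
rewrite inE (negbTE xX) /=; apply: contra xX => xY.
suff -> : x = z by [].
by apply/set1P; rewrite -I !inE eqxx xY.
Qed.

Lemma spath_edge F a b e : e \in F -> joins e a b -> a != b ->
  spath F [set a; b] [set e] (~~ sigma e) a b.
Proof.
move=> eF j ab; have := spath_cons eF j _ (spath_nil F b).
by rewrite in_set1 setU0 addbF; apply.
Qed.

Lemma spath_rev F X P s a b : spath F X P s a b -> spath F X P s b a.
Proof.
elim=> [x|x y z e X' P' s' eF j xX p IH]; first by constructor.
have xy : y != x by apply: contraNneq xX => <-; exact: spath_start p.
have q : spath F [set y; x] [set e] (~~ sigma e) y x by apply: spath_edge; rewrite // joinsC.
have := spath_cat IH q; rewrite addbC [P' :|: _]setUC.
rewrite (_ : X' :|: [set y; x] = x |: X').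
  apply; apply/setP=> w; rewrite in_setI in_set2 in_set1.
  have [->|_] := eqVneq w y; first by rewrite (spath_start p).
  by have [->|_] := eqVneq w x; rewrite ?(negbTE xX) ?andbF.
apply/setP=> w; rewrite in_setU in_set2 in_setU1.
by have [->|_] := eqVneq w y; rewrite ?(spath_start p) ?orbT // orbC.
Qed.

Lemma spath_split F X P s a c b : spath F X P s a c -> b \in X ->
  exists X1 P1 s1 X2 P2 s2, [/\ spath F X1 P1 s1 a b, spath F X2 P2 s2 b c,
    X = X1 :|: X2, X1 :&: X2 = [set b] & s = s1 (+) s2].
Proof.
elim=> [x|x y z e X' P' s' eF j xX p IH].
  rewrite in_set1 => /eqP->.
  exists [set x], set0, false, [set x], set0, false.
  by split; rewrite ?setUid ?setIid //; constructor.
rewrite in_setU1 => /predU1P[->|/IH].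
  exists [set x], set0, false, (x |: X'), (e |: P'), (~~ sigma e (+) s'); split => //.
  - by constructor.
  - exact: spath_cons p.
  - by rewrite setUA setUid.
  - by rewrite setIUr setIid; apply/setUidPl; exact: subsetIl.
case=> X1 [P1 [s1 [X2 [P2 [s2 [p1 p2 Xe I se]]]]]].
exists (x |: X1), (e |: P1), (~~ sigma e (+) s1), X2, P2, s2; split => //.
- by apply: spath_cons p1 => //; apply: contra xX; rewrite Xe inE => ->.
- by rewrite Xe setUA.
- rewrite setIUl I (_ : [set x] :&: X2 = set0) ?set0U //.
  apply/eqP; rewrite setI_eq0 disjoints1; apply: contra xX.
  by rewrite Xe inE => ->; rewrite orbT.
- by rewrite se addbA.
Qed.

(** Truncation at the first vertex in [U]; it lets an ear meet [U] in nothing but its ends. *)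
Lemma spath_first_hit F U X P s a b : spath F X P s a b -> b \in U ->
  exists X' P' s' b', [/\ spath F X' P' s' a b', b' \in U, X' :&: U = [set b'],
    X' \subset X & P' \subset P].
Proof.
elim=> [x|x y z e X' P' s' eF j xX p IH] bU.
  exists [set x], set0, false, x; split; rewrite ?sub0set //; first by constructor.
  by apply/setIidPl; rewrite sub1set.
have [xU|xU] := boolP (x \in U).
  exists [set x], set0, false, x; split; rewrite ?sub0set ?sub1set ?setU11 //.
    by constructor.
  by apply/setIidPl; rewrite sub1set.
have [X1 [P1 [s1 [b' [p1 b'U I sX sP]]]]] := IH bU.
exists (x |: X1), (e |: P1), (~~ sigma e (+) s1), b'; split; rewrite ?setUS //.
  by apply: spath_cons p1 => //; apply: contra xX; exact: subsetP.
rewrite setIUl I (_ : [set x] :&: U = set0) ?set0U //.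
by apply/eqP; rewrite setI_eq0 disjoints1.
Qed.

Lemma connect_spath F a b : connect (adj ends F) a b -> exists X P s, spath F X P s a b.
Proof.
case/connectP=> p0 pp ->.
case/shortenP: pp => p pp; move=> u _ {p0}.
suff [P [s h]] : exists P s, spath F [set x in a :: p] P s a (last a p).
  by exists [set x in a :: p], P, s.
elim: p a pp u => [|y p IH] a /=.
  move=> _ _; exists set0, false; have -> : [set x in [:: a]] = [set a].
    by apply/setP=> z; rewrite !inE.
  by constructor.
case/andP=> /adjP[e eF j] pp /andP[ap u].
have [P [s h]] := IH y pp u.
exists (e |: P), (~~ sigma e (+) s).
rewrite set_cons; apply: spath_cons eF j _ h; by rewrite inE.
Qed.

Lemma spath_circle F X P s a b e : spath F X P s a b -> joins e a b -> e \notin P ->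
  circle (e |: P) /\ verts (e |: P) = X.
Proof.
move=> p j eP.
have d x : deg (e |: P) x = (x \in X).*2.
  by rewrite deg_setU1 // (joins_inc _ j) addnC (spath_deg _ p).
have vX : verts (e |: P) = X.
  by apply/setP=> x; rewrite verts_deg d double_gt0 lt0b.
split=> //; split; first by apply/set0Pn; exists e; rewrite setU11.
- split; first by apply/set0Pn; exists a; rewrite vX (spath_start p).
  have c x : x \in X -> connect (adj ends (e |: P)) a x.
    move=> /(spath_connect p); apply: connect_sub => u w /adjP[f fP jf].
    by apply/connect1/adjP; exists f; rewrite ?in_setU1 ?fP ?orbT.
  move=> x y; rewrite vX => xX yX; apply: connect_trans (c y yX).
  by rewrite (sym_connect_sym (@adj_sym _ _ _ _)) c.
- by move=> x; rewrite vX d => ->.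
Qed.

(** If [e] were a bridge of [D], the component of [a] in [D :\ e] would have [a] as its only vertex
    of odd degree, against the handshake lemma. A path from [a] to [b] avoiding [e] closes with [e]
    to a circle inside [D], hence to [D] itself. *)
Lemma circle_spath D e a b : circle D -> e \in D -> joins e a b ->
  exists s, spath (D :\ e) (verts D) (D :\ e) s a b.
Proof.
move=> cD eD j.
have cn : connect (adj ends (D :\ e)) a b.
  have [->|ab] := eqVneq a b; first exact: connect0.
  apply: contraT => nc.
  pose K := [set x | connect (adj ends (D :\ e)) a x].
  have cl f : f \in D :\ e -> ((ends f).1 \in K) = ((ends f).2 \in K).
    move=> fD; have c1 : connect (adj ends (D :\ e)) (ends f).1 (ends f).2.
      by apply/connect1/adjP; exists f => //; exact: joins_ends.
    rewrite !inE; apply/idP/idP => h; first exact: connect_trans h c1.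
    by apply: connect_trans h _; rewrite (sym_connect_sym (@adj_sym _ _ _ _)).
  have aK : a \in K by rewrite inE connect0.
  have bK : b \notin K by rewrite inE.
  have aD : a \in verts D by apply/vertsP; exists e; rewrite ?(joins_incident j).
  have da : deg (D :\ e) a = 1%N.
    have := circle_deg cD aD; rewrite (deg_setD1 _ _ eD) (joins_inc _ j) eqxx (negbTE ab).
    by case.
  have := handshake cl; rewrite (bigD1 a) //= oddD da /= negbK; apply: contraTT => _.
  elim/big_ind: _ => // [m n|x /andP[xK xa]]; first by rewrite oddD => /negbTE-> /negbTE->.
  have xb : x != b by apply: contraNneq bK => <-.
  have [xD|] := boolP (x \in verts D).
    have := circle_deg cD xD; rewrite (deg_setD1 _ _ eD) (joins_inc _ j).
    by rewrite (negbTE xa) (negbTE xb) add0n => ->.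
  by rewrite verts_deg -leqNgt leqn0 (deg_setD1 _ _ eD) addn_eq0 => /andP[_ /eqP->].
have [X [P [s p]]] := connect_spath cn.
have eP : e \notin P.
  by apply/negP=> /(subsetP (spath_sub p)); rewrite !inE eqxx.
have [c vX] := spath_circle p j eP.
have De : e |: P = D.
  apply: circle_sub_eq cD c _; rewrite subUset sub1set eD.
  exact: subset_trans (spath_sub p) (subsetDl _ _).
have PE : P = D :\ e by rewrite -De setU1K.
have XE : X = verts D by rewrite -De vX.
by exists s; rewrite -{2}PE -XE.
Qed.

(** A simple path using an edge between its own ends consists of that edge alone. A path of the
    opposite sign therefore avoids the edge. *)
Lemma spath_edge_on F X P s a b e : spath F X P s a b -> joins e a b -> e \in P ->
  s = ~~ sigma e.
Proof.
move=> p j eP; case/spath_inv: p => [[_ _ P0 _]|].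
  by rewrite P0 inE in eP.
case=> c [f [X' [P' [s' [_ jf aX p [_ PE ->]]]]]].
have /negP nP := spath_new_edge p aX j.
move: eP; rewrite PE in_setU1 => /predU1P[ef|/nP//].
have cb : c = b by rewrite -(joins_other jf) -ef (joins_other j).
by rewrite cb in p; have [_ _ ->] := spath_loop p; rewrite addbF ef.
Qed.

(** * Two-signed vertex sets, formalised as [both_signs] *)

Definition both_signs F U := forall a b s, a \in U -> b \in U -> a != b ->
  exists X P, spath F X P s a b /\ X \subset U.

(** [a] and [b] cut [D] into two arcs whose signs multiply to -1, so one of them has the required
    sign. *)
Lemma both_signs_circle F D : circle D -> D \subset F -> negative sigma D ->
  both_signs F (verts D).
Proof.
move=> cD DF nD a b t aD bD ab.
have [e eD ia] := vertsP _ _ _ aD.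
have j := incident_joins ia; set a' := other ends a e in j.
have [s p] := circle_spath cD eD j.
have eP : e \notin D :\ e by rewrite !inE eqxx.
have : negative sigma (e |: D :\ e) by rewrite setD1K.
move/(negative_setU1 p eP) => sg.
have [X1 [P1 [s1 [X2 [P2 [s2 [p1 p2 XE I sE]]]]]]] := spath_split p bD.
have aX2 : a \notin X2.
  by apply: contra ab => aX2; rewrite -in_set1 -I inE aX2 (spath_start p1).
have DF' : D :\ e \subset F by apply: subset_trans DF; apply: subsetDl.
(* The second arc starts with [e] and then runs backwards along the part of the path beyond [b]. *)
have q : spath F (a |: X2) (e |: P2) (~~ sigma e (+) s2) a b.
  apply: spath_cons j aX2 (spath_rev (spath_widen DF' p2)); exact: (subsetP DF).
have s12 : t = s1 \/ t = ~~ sigma e (+) s2.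
  by move: sg; rewrite sE; case: (t) (s1) (s2) (sigma e) => -[] [] [] //=; auto.
case: s12 => ->.
  by exists X1, P1; split; [exact: (spath_widen DF' p1)|rewrite XE subsetUl].
exists (a |: X2), (e |: P2); split=> //.
by rewrite subUset sub1set aD XE subsetUr.
Qed.

(** * Ears: paths meeting a two-signed set exactly in their two distinct ends *)

Section Ear.
Variables (F : {set E}) (U Y : {set V}) (x z : V).
Hypotheses (bsU : both_signs F U) (xU : x \in U) (zU : z \in U) (xz : x != z).
Hypothesis (YU : Y :&: U = [set x; z]).

(** Supplies the one-vertex intersection that [spath_cat] asks for where the ear enters [U] at
    [x]. *)
Lemma ear_meet (X1 Xu : {set V}) : X1 \subset Y -> Xu \subset U -> x \in X1 -> x \in Xu ->
  z \notin X1 -> X1 :&: Xu = [set x].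
Proof.
move=> s1 su x1 xu z1; apply/setP=> w; rewrite in_set1 inE.
apply/andP/eqP => [[w1 wu]|-> //].
have : w \in Y :&: U by rewrite inE (subsetP s1) // (subsetP su).
by rewrite YU in_set2 => /orP[/eqP//|/eqP wz]; rewrite -wz w1 in z1.
Qed.

(* The route from [a] to [b] that leaves the ear at [x], crosses [U] and re-enters
   at [z]; the crossing can be taken with either sign. *)
Lemma ear_around (X1 X3 : {set V}) P1 P3 s1 s3 a b s :
  spath F X1 P1 s1 x a -> spath F X3 P3 s3 b z -> [disjoint X1 & X3] ->
  X1 \subset Y -> X3 \subset Y ->
  exists X P, spath F X P s a b /\ X \subset U :|: Y.
Proof.
move=> p1 p3 dis s1Y s3Y.
(* This sign for the crossing cancels those of the two ear pieces and leaves [s] in total. *)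
have [Xu [Pu [pu sU]]] := bsU (s1 (+) s3 (+) s) xU zU xz.
have z1 : z \notin X1 by rewrite (disjointFl dis) // (spath_end p3).
have x3 : x \notin X3 by rewrite (disjointFr dis) // (spath_start p1).
have I1 : X1 :&: Xu = [set x].
  exact: ear_meet s1Y sU (spath_start p1) (spath_start pu) z1.
have q := spath_cat (spath_rev p1) pu I1.
have I3 : (X1 :|: Xu) :&: X3 = [set z].
  rewrite setIUl (disjoint_setI0 dis) set0U.
  apply/setP=> w; rewrite in_set1 inE; apply/andP/eqP => [[wu w3]|->].
    have : w \in Y :&: U by rewrite inE (subsetP s3Y) // (subsetP sU).
    by rewrite YU in_set2 => /orP[/eqP wx|/eqP//]; rewrite -wx w3 in x3.
  by rewrite (spath_end pu) (spath_end p3).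
have := spath_cat q (spath_rev p3) I3.
rewrite (_ : _ (+) _ (+) s3 = s); last by case: (s1) (s3) (s) => -[] [].
move=> r; do 2 eexists; split; first exact: r.
rewrite !subUset; apply/andP; split; last exact: subset_trans s3Y (subsetUr _ _).
by rewrite (subset_trans s1Y (subsetUr _ _)) (subset_trans sU (subsetUl _ _)).
Qed.

(** Go back along the ear from [a] to [x], then through [U] to [b] with the sign that corrects the
    ear piece. *)
Lemma ear_to_base Q t a b s : spath F Y Q t x z -> a \in Y -> a \notin U ->
  b \in U -> b \notin Y -> exists X P, spath F X P s a b /\ X \subset U :|: Y.
Proof.
move=> q aY aU bU bY.
have [X1 [P1 [s1 [X2 [P2 [s2 [p1 p2 YE I tE]]]]]]] := spath_split q aY.
have z1 : z \notin X1.
  apply: contra aU => z1; suff -> : a = z by [].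
  by apply/esym/set1P; rewrite -I inE z1 (spath_end p2).
have xb : x != b by apply: contraNneq bY => <-; apply: spath_start q.
have [Xu [Pu [pu sU]]] := bsU (s1 (+) s) xU bU xb.
have s1Y : X1 \subset Y by rewrite YE subsetUl.
have I1 := ear_meet s1Y sU (spath_start p1) (spath_start pu) z1.
have := spath_cat (spath_rev p1) pu I1; rewrite addKb => r.
do 2 eexists; split; first exact: r.
by rewrite setUC setUSS.
Qed.

(** Pairs inside [U] need nothing new, pairs on the ear go around through [U] by [ear_around], and
    the remaining mixed pairs are [ear_to_base]. *)
Lemma both_signs_ear Q t : spath F Y Q t x z -> both_signs F (U :|: Y).
Proof.
move=> q.
have inY a b s : a \in Y -> b \in Y -> a != b ->
    exists X P, spath F X P s a b /\ X \subset U :|: Y.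
  move=> aY bY ab.
  have [X1 [P1 [s1 [X2 [P2 [s2 [p1 p2 YE I tE]]]]]]] := spath_split q aY.
  have X1Y : X1 \subset Y by rewrite YE subsetUl.
  have X2Y : X2 \subset Y by rewrite YE subsetUr.
  have /setUP[b1|b2] : b \in X1 :|: X2 by rewrite -YE.
    (* Here [b] precedes [a] on the ear: the route leaves from [b] towards [x], returns from [z] to
       [a], and is finally reversed. *)
    have [X3 [P3 [s3 [X4 [P4 [s4 [p3 p4 XE I' sE]]]]]]] := spath_split p1 b1.
    have X31 : X3 \subset X1 by rewrite XE subsetUl.
    have a3 : a \notin X3.
      apply: contra ab => a3; rewrite -in_set1 -I' inE a3; exact: spath_end p4.
    have dis : [disjoint X3 & X2].
      rewrite -setI_eq0; apply/eqP/setP=> w; rewrite inE in_set0; apply/negP=> /andP[w3 w2].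
      have /set1P wa : w \in [set a] by rewrite -I inE w2 (subsetP X31).
      by rewrite wa (negbTE a3) in w3.
    have [X [P [p sX]]] := ear_around s p3 p2 dis (subset_trans X31 X1Y) X2Y.
    exists X, P; split => //; exact: spath_rev p.
  have [X3 [P3 [s3 [X4 [P4 [s4 [p3 p4 XE I' sE]]]]]]] := spath_split p2 b2.
  have X42 : X4 \subset X2 by rewrite XE subsetUr.
  have a4 : a \notin X4.
    apply: contra ab => a4; rewrite -in_set1 -I' inE a4 andbT; exact: spath_start p3.
  have dis : [disjoint X1 & X4].
    rewrite -setI_eq0; apply/eqP/setP=> w; rewrite inE in_set0; apply/negP=> /andP[w1 w4].
    have /set1P wa : w \in [set a] by rewrite -I inE w1 (subsetP X42).
    by rewrite wa (negbTE a4) in w4.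
  exact: ear_around s p1 p4 dis X1Y (subset_trans X42 X2Y).
move=> a b s; rewrite !inE.
case: (boolP (a \in U)) => aU; case: (boolP (b \in U)) => bU /=.
- move=> _ _ ab; have [X [P [p sX]]] := bsU s aU bU ab.
  by exists X, P; split => //; apply: subset_trans sX (subsetUl _ _).
- move=> _ bY ab; case: (boolP (a \in Y)) => aY; first exact: inY.
  have [X [P [p sX]]] := ear_to_base s q bY bU aU aY.
  by exists X, P; split => //; exact: spath_rev p.
- move=> aY _ ab; case: (boolP (b \in Y)) => bY; first exact: inY.
  exact: ear_to_base s q aY aU bU bY.
- exact: inY.
Qed.

End Ear.

(** Take an edge from [x] in [U] to [y] outside, and let [R] be what [y] reaches without edges at
    [x]. If [R] missed [U], then [x] would be a cutpoint; otherwise a path from [y] within [R] first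
    hits [U] at some [z] other than [x], which completes the ear. *)
Lemma ear_exists W F U e0 : wf_sub ends W F -> connected_sub ends W F -> nocut ends W F ->
  U \subset W -> U != W -> e0 \in F -> (ends e0).1 \in U -> (ends e0).2 \in U ->
  exists x z Y Q s, [/\ spath F Y Q s x z, x \in U /\ z \in U, x != z,
    Y :&: U = [set x; z] & Y \subset W /\ ~~ (Y \subset U)].
Proof.
move=> wf [_ cn] nc UW neU e0F e01 e02.
have [w wW wU] : exists2 w, w \in W & w \notin U.
  by apply/subsetPn; apply: contra neU => WU; rewrite eqEsubset UW.
have [x [y [e [xU yU eF j]]]] :=
  connect_cross e01 wU (cn _ _ (subsetP UW _ e01) wW).
have inW f u u' : f \in F -> joins f u u' -> u \in W /\ u' \in W.
  by move=> fF; have [h1 h2] := wf f fF; case/joinsP=> -[<- <-].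
have [xW yW] := inW _ _ _ eF j.
pose F' := [set f in F | ~~ incident ends x f].
have [R RE] : exists R : {set V}, forall u, (u \in R) = connect (adj ends F') y u.
  by exists [set u | connect (adj ends F') y u] => u; rewrite in_set.
have F'F : F' \subset F by apply/subsetP=> f; rewrite inE => /andP[].
have avoid X P s a b : spath F' X P s a b -> x != a -> x != b -> x \notin X.
  move=> p xa xb; have := spath_deg x p; rewrite (negbTE xa) (negbTE xb).
  suff -> : deg P x = 0%N by case: (x \in X).
  rewrite degE big1 // => f /(subsetP (spath_sub p)); rewrite inE -inc_gt0 => /andP[_].
  by case: inc.
have yx : x != y by apply: contraNneq yU => <-.
have xR : x \notin R.
  rewrite RE; apply/negP => /connectP[p pp xl].
  case: (lastP p) pp xl yx => [|p' l] /=; first by move=> _ ->; rewrite eqxx.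
  rewrite rcons_path last_rcons => /andP[_ /adjP[f fF' jf]] xl _.
  by move: fF'; rewrite inE xl (joins_incident (y := last y p')) ?andbF // joinsC.
have RW u : u \in R -> u \in W.
  rewrite RE => /connectP[p pp ->].
  elim: p y yW pp {j yU yx R RE xR} => //= u' p IH y' y'W /andP[/adjP[f fF' jf]].
  by apply: IH; have [] := inW _ _ _ (subsetP F'F _ fF') jf.
have Rstep f u u' : f \in F -> joins f u u' -> u \in R -> u' \in x |: R.
  move=> fF jf uR; rewrite in_setU1; case: eqVneq => //= u'x.
  have ux : u != x by apply: contraNneq xR => <-.
  move: uR; rewrite !RE => uR; apply: connect_trans uR (connect1 _).
  apply/adjP; exists f => //; rewrite inE fF -inc_gt0 (joins_inc _ jf).
  by rewrite ![x == _]eq_sym (negbTE ux) (negbTE u'x).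
case: (boolP [disjoint R & U]) => dis.
  have [F1 F1E] : exists F1 : {set E}, forall f,
      (f \in F1) = (f \in F) && (((ends f).1 \in R) || ((ends f).2 \in R)).
    by exists [set f in F | ((ends f).1 \in R) || ((ends f).2 \in R)] => f; rewrite in_set.
  (* [x] cuts off [R] with all edges meeting it. The edge [e] is on that side, and [e0], having both
     ends in [U], is on the other. *)
  exfalso; apply: (nc x); exists (x |: R), (W :\: R), F1, (F :\: F1).
  have out u : u \in U -> u \notin R by move=> uU; rewrite (disjointFl dis).
  have yR : y \in R by rewrite RE connect0.
  split.
  - split=> f.
      rewrite F1E => /andP[fF /orP[h|h]].
        by rewrite (Rstep _ _ _ fF (joins_ends ends f) h) in_setU1 h orbT.
      have jf : joins f (ends f).2 (ends f).1 by rewrite joinsC joins_ends.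
      by rewrite (Rstep _ _ _ fF jf h) in_setU1 h orbT.
    rewrite in_setD F1E !in_setD; case/andP=> + fF; rewrite fF negb_or => /andP[-> ->].
    by have [-> ->] := wf f fF.
  - apply/setP=> u; rewrite in_setU in_setU1 in_setD.
    case: eqVneq => [->|_] /=; first by rewrite xW.
    by case: (boolP (u \in R)) => // /RW->.
  - by rewrite -[RHS](setID F F1); congr (_ :|: _); apply/setP=> f; rewrite inE F1E; case: (f \in F).
  - split; first by rewrite -setI_eq0 setIDA setD_eq0 subsetIl.
    apply/setP=> u; rewrite in_setI in_setU1 in_setD in_set1.
    case: eqVneq => [->|_] /=; first by rewrite xR xW.
    by case: (u \in R).
  - apply/andP; split; apply/set0Pn.
      exists e; rewrite F1E eF /=.
      by case/joinsP: j => -[-> ->]; rewrite yR ?orbT.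
    by exists e0; rewrite in_setD e0F andbT F1E e0F /= negb_or !out.
case/pred0Pn: dis => z0 /andP[/= z0R z0U]; rewrite RE in z0R.
have [X [P [s p]]] := connect_spath z0R.
have xz0 : x != z0 by apply: contraNneq xR => ->; rewrite RE.
have [X' [P' [s' [z [p' zU I sX sP]]]]] := spath_first_hit p z0U.
have xX' : x \notin X' by apply: contra (avoid _ _ _ _ _ p yx xz0); exact: subsetP.
exists x, z, (x |: X'), (e |: P'), (~~ sigma e (+) s'); split=> //.
- exact: spath_cons j xX' (spath_widen F'F p').
- by apply: contraNneq xX' => ->; exact: spath_end p'.
- by rewrite setIUl I; congr (_ :|: _); apply/setIidPl; rewrite sub1set.
- split; last first.
    by apply: contra yU => /subsetP; apply; rewrite in_setU1 (spath_start p') orbT.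
  rewrite subUset sub1set xW; apply/subsetP=> u uX'; apply: RW; rewrite RE.
  apply: connect_sub (spath_connect p' uX') => a b /adjP[f fP jf].
  apply/connect1/adjP; exists f => //; exact: subsetP (spath_sub p') _ fP.
Qed.

(** Induction on the number of vertices of [W] outside [U]: each ear brings in at least one of
    them. *)
Lemma both_signs_grow W F U e0 : wf_sub ends W F -> connected_sub ends W F -> nocut ends W F ->
  e0 \in F -> U \subset W -> (ends e0).1 \in U -> (ends e0).2 \in U ->
  both_signs F U -> both_signs F W.
Proof.
move=> wf cn nc e0F; have [n] := ubnP #|W :\: U|.
elim: n U => // n IH U ltn UW e01 e02 bs.
have [<- //|neU] := eqVneq U W.
have [x [z [Y [Q [s [q [xU zU] xz YU [YW YnU]]]]]]] := ear_exists wf cn nc UW neU e0F e01 e02.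
apply: (IH (U :|: Y) _ _ _ _ (both_signs_ear bs xU zU xz YU q));
  rewrite ?inE ?e01 ?e02 ?subUset ?UW //.
have [y yY yU] := subsetPn YnU.
rewrite ltnS in ltn; apply: leq_trans ltn; apply: proper_card; apply/properP; split.
  by apply: setDS; exact: subsetUl.
by exists y; rewrite !inE ?yU ?yY ?orbT //= (subsetP YW).
Qed.

(** The vertex of a loop separates the loop from all other edges in the sense of [cutpoint], so
    there can be no others. *)
Lemma loop_nocut W F g a : wf_sub ends W F -> nocut ends W F -> g \in F -> joins g a a ->
  F = [set g].
Proof.
move=> wf nc gF j; apply/eqP; apply: contraT => ne.
have [ga1 ga2] : (ends g).1 = a /\ (ends g).2 = a by case/joinsP: j => -[-> ->].
have aW : a \in W by rewrite -ga1; have [] := wf g gF.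
exfalso; apply: (nc a); exists [set a], W, [set g], (F :\ g); split.
- split=> [f /set1P->|f]; first by rewrite ga1 ga2 !set11.
  by rewrite inE => /andP[_ /wf].
- by apply/setUidPr; rewrite sub1set.
- exact: setD1K.
- split; last by apply/setIidPl; rewrite sub1set.
  by rewrite disjoints1 !inE eqxx.
- apply/andP; split; first by apply/set0Pn; exists g; rewrite set11.
  apply: contra ne => /eqP F0; by rewrite -(setD1K gF) F0 setU0.
Qed.

Lemma unbalanced_edge W F f : wf_sub ends W F -> connected_sub ends W F -> nocut ends W F ->
  unbalanced ends sigma F -> f \in F ->
  exists D, [/\ circle D, D \subset F, f \in D & negative sigma D].
Proof.
move=> wf cn nc [D [cD DF nD]] fF.
have [e0 e0D] := circle_nonempty cD.
have e0F := subsetP DF _ e0D.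
have [fD|fD] := boolP (f \in D); first by exists D.
(* [F] has no loop here: a loop would be its only edge, and [f] would then lie on [D]. *)
have nl e a b : e \in F -> joins e a b -> a != b.
  move=> eF j; apply: contraNneq fD => ab; rewrite ab in j.
  have FE := loop_nocut wf nc eF j.
  have /set1P-> : f \in [set e] by rewrite -FE.
  by have /set1P<- : e0 \in [set e] by rewrite -FE.
have sW : verts D \subset W.
  apply/subsetP=> x /vertsP[e eD]; have [h1 h2] := wf e (subsetP DF _ eD).
  by case/orP=> /eqP<-.
have i1 : (ends e0).1 \in verts D.
  by apply/vertsP; exists e0 => //; rewrite /incident eqxx.
have i2 : (ends e0).2 \in verts D.
  by apply/vertsP; exists e0 => //; rewrite /incident eqxx orbT.
have bs := both_signs_grow wf cn nc e0F sW i1 i2 (both_signs_circle cD DF nD).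
have j := joins_ends ends f; have [f1 f2] := wf f fF.
(* The path bit is true for negative and [sigma] is true for positive, so the bit [sigma f] requests
   the sign opposite to that of [f]. *)
have [X [P [p sX]]] := bs _ _ (sigma f) f1 f2 (nl _ _ _ fF j).
have fP : f \notin P.
  by apply/negP=> /(spath_edge_on p j); case: (sigma f).
have [c _] := spath_circle p j fP.
exists (f |: P); split; rewrite ?setU11 ?subUset ?sub1set ?fF ?(spath_sub p) //.
by apply/(negative_setU1 p fP); case: (sigma f).
Qed.

End SignedPaths.

(** * Blocks: existence, uniqueness through an edge, and circles at a vertex *)

Section Blocks.
Variables (V E : finType) (ends : E -> V * V).
Implicit Types (W : {set V}) (F D : {set E}) (v w : V) (e : E).

Lemma verts_wf F : wf_sub ends (verts ends F) F.
Proof.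
by move=> e eF; split; apply/vertsP; exists e; rewrite // /incident eqxx ?orbT.
Qed.

(** If [F] had edges on both sides, the traces of the separation on [(W, F)] would make [w] a
    cutpoint when [w] is in [W], and would disconnect [(W, F)] when it is not. *)
Lemma nocut_one_side W F W1 F1 W2 F2 w : wf_sub ends W F -> connected_sub ends W F ->
  nocut ends W F -> wf_sub ends W1 F1 -> wf_sub ends W2 F2 -> W \subset W1 :|: W2 ->
  F \subset F1 :|: F2 -> [disjoint F1 & F2] -> W1 :&: W2 = [set w] ->
  F \subset F1 \/ F \subset F2.
Proof.
move=> wf [_ cn] nc wf1 wf2 WU FU dis WI.
have sub (A B : {set E}) : F \subset A :|: B -> F :&: A = set0 -> F \subset B.
  move=> s I0; apply/subsetP=> e eF; have := subsetP s e eF.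
  rewrite inE => /orP[eA|//]; have : e \in F :&: A by rewrite inE eF.
  by rewrite I0 inE.
have [I1|n1] := eqVneq (F :&: F1) set0; first by right; apply: sub I1.
have [I2|n2] := eqVneq (F :&: F2) set0; first by left; apply: sub I2; rewrite setUC.
exfalso; have [wW|wW] := boolP (w \in W).
  apply: (nc w); exists (W :&: W1), (W :&: W2), (F :&: F1), (F :&: F2); split.
  - split=> e; rewrite inE => /andP[eF eF']; rewrite !inE; have [-> ->] := wf e eF.
      by have [-> ->] := wf1 e eF'.
    by have [-> ->] := wf2 e eF'.
  - by rewrite -setIUr; apply/setIidPl.
  - by rewrite -setIUr; apply/setIidPl.
  - split; last by rewrite setIACA setIid WI; apply/setIidPr; rewrite sub1set.
    by rewrite -setI_eq0 setIACA (disjoint_setI0 dis) setI0.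
  - by rewrite n1 n2.
have [e1 /setIP[e1F e1F1]] := set0Pn _ n1; have [e2 /setIP[e2F e2F2]] := set0Pn _ n2.
have out x : x \in W -> x \in W2 -> (x \in W1) = false.
  move=> xW x2; apply/negP=> x1; case/negP: wW.
  have /set1P<- // : x \in [set w] by rewrite -WI inE x1.
have cl e : e \in F -> ((ends e).1 \in W1) = ((ends e).2 \in W1).
  move=> eF; have := subsetP FU e eF; rewrite inE => /orP[/wf1[-> ->]//|/wf2[h1 h2]].
  by have [w1 w2] := wf e eF; rewrite !out.
have [a1 _] := wf1 e1 e1F1; have [a2 _] := wf e1 e1F.
have [b1 _] := wf2 e2 e2F2; have [b2 _] := wf e2 e2F.
by have := adj_connect_closed cl a1 (cn _ _ a2 b2); rewrite out.
Qed.

Lemma setU_wf W F W' F' : wf_sub ends W F -> wf_sub ends W' F' ->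
  wf_sub ends (W :|: W') (F :|: F').
Proof.
by move=> h h' e /setUP[/h|/h'] [h1 h2]; rewrite !inE h1 h2 ?orbT.
Qed.

Lemma setU_connected W F W' F' w : connected_sub ends W F -> connected_sub ends W' F' ->
  w \in W -> w \in W' -> connected_sub ends (W :|: W') (F :|: F').
Proof.
move=> [_ c] [_ c'] wW wW'.
have widen (A B : {set E}) x y : A \subset B ->
    connect (adj ends A) x y -> connect (adj ends B) x y.
  move=> AB; apply: connect_sub => a b /adjP[e eA j]; apply/connect1/adjP.
  by exists e => //; apply: subsetP eA.
have cw x : x \in W :|: W' -> connect (adj ends (F :|: F')) w x.
  case/setUP=> xW.
    exact: widen (subsetUl _ _) (c _ _ wW xW).
  exact: widen (subsetUr _ _) (c' _ _ wW' xW).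
split; first by apply/set0Pn; exists w; rewrite inE wW.
move=> x y xU yU; apply: connect_trans (cw y yU).
by rewrite (sym_connect_sym (@adj_sym _ _ _ _)) cw.
Qed.

(** In a separation of the union, each of the two subgraphs has its edges on one side. The common
    edge [e] forces the same side, leaving the other without edges. *)
Lemma setU_nocut W F W' F' e : wf_sub ends W F -> connected_sub ends W F ->
  nocut ends W F -> wf_sub ends W' F' -> connected_sub ends W' F' -> nocut ends W' F' ->
  e \in F -> e \in F' -> nocut ends (W :|: W') (F :|: F').
Proof.
move=> wf cn nc wf' cn' nc' eF eF' w.
case=> W1 [W2 [F1 [F2 [[wf1 wf2] WU FU [dis WI] /andP[n1 n2]]]]].
have side : F \subset F1 \/ F \subset F2.
  by apply: nocut_one_side wf cn nc wf1 wf2 _ _ dis WI; rewrite ?WU ?FU subsetUl.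
have side' : F' \subset F1 \/ F' \subset F2.
  by apply: nocut_one_side wf' cn' nc' wf1 wf2 _ _ dis WI; rewrite ?WU ?FU subsetUr.
have no (A B : {set E}) : [disjoint A & B] -> A :|: B = F :|: F' -> B != set0 ->
    F \subset A -> F' \subset A -> False.
  move=> d U /set0Pn[f fB] s s'; have : f \in A :|: B by rewrite inE fB orbT.
  rewrite U => /setUP[/(subsetP s)|/(subsetP s')] fA; by rewrite (disjointFr d fA) in fB.
have dis' : [disjoint F2 & F1] by rewrite disjoint_sym.
case: side side' => s [] s'.
- exact: no dis FU n2 s s'.
- by have := subsetP s _ eF; rewrite (disjointFl dis (subsetP s' _ eF')).
- by have := subsetP s _ eF; rewrite (disjointFr dis (subsetP s' _ eF')).
- by apply: (no F2 F1); rewrite // setUC.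
Qed.

(** The union of the two blocks has no cutpoint because of the shared edge, so by maximality both
    equal it. *)
Lemma block_shared_edge W F W' F' e : block ends W F -> block ends W' F' ->
  e \in F -> e \in F' -> W' = W /\ F' = F.
Proof.
move=> [wf cn nc mx] [wf' cn' nc' mx'] eF eF'.
have wU := setU_wf wf wf'.
have cU := setU_connected cn cn' (proj1 (wf e eF)) (proj1 (wf' e eF')).
have nU := setU_nocut wf cn nc wf' cn' nc' eF eF'.
have [W1 F1] := mx _ _ wU cU nU (subsetUl _ _) (subsetUl _ _).
have [W2 F2] := mx' _ _ wU cU nU (subsetUr _ _) (subsetUr _ _).
by split; [rewrite -[LHS]W2|rewrite -[LHS]F2].
Qed.

(** Enlarging as long as maximality fails must stop, since each enlargement lowers the number of
    vertices and edges left out. *)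
Lemma nocut_in_block W F : wf_sub ends W F -> connected_sub ends W F -> nocut ends W F ->
  exists W' F', [/\ block ends W' F', W \subset W' & F \subset F'].
Proof.
have [n] := ubnP (#|~: W| + #|~: F|); elim: n W F => // n IH W F ltn wf cn nc.
have [bl|nbl] := classic (block ends W F); first by exists W, F.
have [W' [F' [wf' cn' nc' [WW' FF' ne]]]] : exists W' F', [/\ wf_sub ends W' F',
    connected_sub ends W' F', nocut ends W' F' &
    [/\ W \subset W', F \subset F' & ~ (W' = W /\ F' = F)]].
  apply: NNPP => no; apply: nbl; split=> // W' F' wf' cn' nc' WW' FF'.
  by apply: NNPP => ne; apply: no; exists W', F'.
have [|//|//|//|W2 [F2 [b s1 s2]]] := IH W' F'; last first.
  by exists W2, F2; split=> //; [exact: subset_trans s1 | exact: subset_trans s2].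
have s1 : ~: W' \subset ~: W by rewrite setCS.
have s2 : ~: F' \subset ~: F by rewrite setCS.
have := subset_leqif_cards s1; have := subset_leqif_cards s2.
move=> [l2 q2] [l1 q1]; rewrite ltnS in ltn; apply: leq_trans ltn.
rewrite ltn_neqAle leq_add // andbT; apply/negP=> /eqP eq; apply: ne.
have /eqP : #|~: W'| == #|~: W| by rewrite eqn_leq l1 /=; lia.
have /eqP : #|~: F'| == #|~: F| by rewrite eqn_leq l2 /=; lia.
move/eqP; rewrite q2 => /eqP/setC_inj ->; move/eqP; rewrite q1 => /eqP/setC_inj ->.
by [].
Qed.

Lemma circle_in_block D : circle ends D ->
  exists W F, [/\ block ends W F, verts ends D \subset W & D \subset F].
Proof.
move=> cD; apply: nocut_in_block; [exact: verts_wf | by case: cD | exact: circle_nocut].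
Qed.

Lemma connected_edge_at W F v e : wf_sub ends W F -> connected_sub ends W F -> v \in W ->
  e \in F -> exists2 f, f \in F & incident ends v f.
Proof.
move=> wf [_ cn] vW eF; have [eW _] := wf e eF.
have [p pp xl] := connectP (cn _ _ vW eW); case: p pp xl => [_ /= ev|y p /= /andP[]].
  by exists e; rewrite // /incident ev eqxx.
by move=> /adjP[f fF j] _ _; exists f => //; exact: joins_incident j.
Qed.

Lemma circle_two_edges D v : circle ends D -> v \in verts ends D -> (1 < #|D|)%N ->
  exists e1 e2, [/\ e1 != e2, e1 \in D, e2 \in D, incident ends v e1 & incident ends v e2].
Proof.
move=> cD vD D1; have [e eD ie] := vertsP _ _ _ vD.
have j := incident_joins ie.
have [f] : exists2 f, f \in D :\ e & incident ends v f.
  apply: deg_other_edge (eD) _; rewrite (circle_deg cD vD) (joins_inc _ j) eqxx.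
  (* If [e] is a loop, the path formed by the rest of [D] goes from [v] to [v], hence is empty, and
     [D] has a single edge. *)
  case: eqVneq => // va; rewrite -va in j.
  have [s p] := circle_spath xpredT cD eD j; have [_ De _] := spath_loop p.
  by move: D1; rewrite (cardsD1 e) eD De cards0.
by rewrite !inE => /andP[ne fD] jf; exists e, f; split; rewrite // eq_sym.
Qed.

(** [D] already accounts for the whole degree of [F] at [v]. *)
Lemma circle_uses_edge F D v e : circle ends D -> D \subset F -> v \in verts ends D ->
  deg ends F v = 2%N -> e \in F -> incident ends v e -> e \in D.
Proof.
move=> cD DF vD dF eF ie; apply: contraT => nD.
have := deg_subD ends v DF; rewrite dF (circle_deg cD vD) => /eqP.
rewrite -[X in X == _]addn0 eqn_add2l eq_sym => /eqP/deg_eq0/(_ e).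
by rewrite inE nD eF ie => /(_ isT).
Qed.

End Blocks.

(** * Suppression: transport of paths and signs *)

Section Suppression.
Variables (V E : finType) (ends : E -> V * V) (sigma : E -> bool) (v : V) (e1 e2 : E).
Implicit Types (F D P : {set E}) (x y : V) (s : bool).
Local Notation ends' := (sup_ends ends v e1 e2).
Local Notation sigma' := (sup_sigma sigma e1 e2).

Lemma sup_edges_Some D e : (Some e \in sup_edges D e1 e2) = (e \in D :\: [set e1; e2]).
Proof. by rewrite /sup_edges in_setU1 mem_imset //; exact: Some_inj. Qed.

Lemma sup_edges_None D : None \in sup_edges D e1 e2.
Proof. by rewrite in_setU1 eqxx. Qed.

Lemma sup_edges_sub D F : D \subset F -> sup_edges D e1 e2 \subset sup_edges F e1 e2.
Proof. by move=> DF; rewrite setUS // imsetS // setSD. Qed.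

(** [sup_edges] forgets whether [e1] and [e2] were present, hence the four membership hypotheses. *)
Lemma sup_edges_inj D D' : e1 \in D -> e2 \in D -> e1 \in D' -> e2 \in D' ->
  sup_edges D e1 e2 = sup_edges D' e1 e2 -> D = D'.
Proof.
move=> h1 h2 h1' h2' eq; apply/setP=> f.
have := sup_edges_Some D' f; rewrite -eq sup_edges_Some !inE.
case: eqVneq => [->|_]; first by rewrite h1 h1'.
by case: eqVneq => [->|_ //]; rewrite h2 h2'.
Qed.

Lemma spath_suppress F X P s x y : spath ends sigma F X P s x y ->
  spath ends' sigma' (Some @: F) X (Some @: P) s x y.
Proof.
elim=> [z|a b c e X' P' s' eF j aX p IH]; first by rewrite imset0; constructor.
rewrite imsetU1; apply: (spath_cons (sigma := sigma') (e := Some e) (b := b)) => //.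
exact: imset_f.
Qed.

Lemma spath_unsuppress F X (P' : {set option E}) s x y : spath ends' sigma' (Some @: F) X P' s x y ->
  exists2 P : {set E}, P' = Some @: P & spath ends sigma F X P s x y.
Proof.
elim=> [z|a b c _ X' Q' s' /imsetP[e eF ->] j aX p [P -> IH]].
  by exists set0; rewrite ?imset0 //; constructor.
exists (e |: P); first by rewrite imsetU1.
exact: spath_cons eF j aX IH.
Qed.

(** The factor of [None] is the product of the factors of [e1] and [e2]. *)
Lemma csign_suppress D : e1 != e2 -> e1 \in D -> e2 \in D ->
  csign sigma' (sup_edges D e1 e2) = csign sigma D.
Proof.
move=> ne h1 h2; rewrite /csign /sup_edges big_setU1 /=; last first.
  by apply/imsetP=> -[].
rewrite big_imset /=; last by move=> ? ? _ _ [].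
have h2' : e2 \in D :\ e1 by rewrite !inE eq_sym ne.
rewrite (big_setD1 e1 h1) (big_setD1 e2 h2') /=.
rewrite setDDl mulrA; congr (_ * _)%R.
by case: (sigma e1) (sigma e2) => -[].
Qed.

End Suppression.

(** * The correspondence between circles through [v] and circles through [None] *)

Section SuppressedCircles.
Variables (V E : finType) (ends : E -> V * V) (v : V) (e1 e2 : E) (F : {set E}).
Implicit Type D : {set E}.
Local Notation ends' := (sup_ends ends v e1 e2).
Local Notation v1 := (other ends v e1).
Local Notation v2 := (other ends v e2).
Hypotheses (ne : e1 != e2) (e1F : e1 \in F) (e2F : e2 \in F).
Hypotheses (i1 : incident ends v e1) (i2 : incident ends v e2) (dv : deg ends F v = 2%N).

Let j1 : joins ends e1 v v1. Proof. exact: incident_joins. Qed.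
Let j2 : joins ends e2 v v2. Proof. exact: incident_joins. Qed.

Let nl1 : v != v1.
Proof.
have [+ _ _] := deg2_edges dv ne e1F e2F i1 i2; rewrite (joins_inc _ j1) eqxx.
by case: eqVneq.
Qed.

Let nl2 : v != v2.
Proof.
have [_ + _] := deg2_edges dv ne e1F e2F i1 i2; rewrite (joins_inc _ j2) eqxx.
by case: eqVneq.
Qed.

Let joins_None : joins ends' None v2 v1.
Proof. by rewrite /joins /= eqxx orbT. Qed.

(* The constant signature [xpredT] is a dummy: circles do not depend on signs. *)
Lemma suppress_circle D : circle ends D -> D \subset F -> e1 \in D -> e2 \in D ->
  circle ends' (sup_edges D e1 e2).
Proof.
move=> cD DF e1D e2D.
(* Opened at [e1], the circle is a path from [v] to [v1]. Its first edge can only be [e2]; without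
   it, a path from [v2] to [v1] remains, which [None] closes. *)
have [s] := circle_spath xpredT cD e1D j1.
case/spath_inv=> [[vv _ _ _]|]; first by have := nl1; rewrite -vv eqxx.
case=> c [f [X [Q [t [fD jf vX p [_ DE _]]]]]].
have fe2 : f = e2.
  have [_ _ /deg_eq0 no] := deg2_edges dv ne e1F e2F i1 i2.
  apply/eqP; apply: contraT => fe2; have := no f.
  move: fD; rewrite !inE => /andP[fe1 fD].
  by rewrite negb_or fe1 fe2 (subsetP DF) // (joins_incident jf) => /(_ isT).
rewrite fe2 in jf DE; rewrite -(joins_other jf) in p.
have fQ : e2 \notin Q by apply: spath_new_edge p vX jf.
have QE : Q = D :\: [set e1; e2] by rewrite -setDDl DE setU1K.
have p' := spath_restrict p (subxx Q).
have q := spath_suppress v e1 e2 p'.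
have NQ : None \notin Some @: Q by apply/imsetP=> -[].
by have [c' _] := spath_circle q joins_None NQ; rewrite /sup_edges -QE.
Qed.

Lemma unsuppress_circle (D' : {set option E}) : circle ends' D' ->
  D' \subset sup_edges F e1 e2 -> None \in D' ->
  exists D, [/\ circle ends D, D \subset F, e1 \in D, e2 \in D & sup_edges D e1 e2 = D'].
Proof.
move=> cD' sub ND'.
have [s p'] := circle_spath (sup_sigma xpredT e1 e2) cD' ND' joins_None.
have sub' : D' :\ None \subset Some @: (F :\: [set e1; e2]).
  by rewrite subDset.
have [Q QE p] := spath_unsuppress (spath_widen sub' p').
have [_ _ d0] := deg2_edges dv ne e1F e2F i1 i2.
have QF := spath_sub p.
(* The old edges left in the path do not meet [v], and [v] is neither of its ends, so [spath_deg]
   excludes [v]; the prefixed path is thus simple. *)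
have vX : v \notin verts ends' D'.
  have := spath_deg v p; rewrite (negbTE nl1) (negbTE nl2) !addn0.
  have := deg_sub ends v QF; rewrite d0 leqn0 => /eqP->.
  by case: (v \in _).
have [n1 n2] : e1 \notin Q /\ e2 \notin Q.
  by split; apply/negP=> /(subsetP QF); rewrite !inE eqxx ?orbT.
have FF : F :\: [set e1; e2] \subset F := subsetDl _ _.
have q := spath_cons e2F j2 vX (spath_widen FF p).
have n12 : e1 \notin e2 |: Q by rewrite in_setU1 negb_or ne.
have [c _] := spath_circle q j1 n12.
exists (e1 |: (e2 |: Q)); split; rewrite ?setU11 //.
- by rewrite !subUset !sub1set e1F e2F (subset_trans QF).
- by rewrite !in_setU1 eqxx orbT.
- rewrite /sup_edges -setDDl !setU1K // -QE setD1K //.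
Qed.

End SuppressedCircles.

(** * The equivalence for vertex batteries *)

Theorem mainTheorem10 (V E : finType) (ends : E -> V * V) (sigma : E -> bool)
    (v : V) (C : {set E}) (WB : {set V}) (FB : {set E}) :
  (* every block containing v contains a circle *)
  (forall W F, block ends W F -> v \in W -> exists D, circle ends D /\ D \subset F) ->
  (* C is a circle containing v, not a loop *)
  circle ends C -> v \in verts ends C -> (1 < #|C|)%N ->
  (* B = (WB, FB) is the block containing C *)
  block ends WB FB -> C \subset FB ->
  neg_vertex_battery ends sigma v C
  <->
  ( (* (1) *)
    [/\ unbalanced ends sigma FB,
        (forall W F, block ends W F -> v \in W -> unbalanced ends sigma F ->
                     W = WB /\ F = FB)
      & deg ends FB v = 2%N]
    /\
    (* (2): for the two edges e1 = v v1, e2 = v v2 of B at v *)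
    (forall e1 e2, e1 != e2 -> e1 \in FB -> e2 \in FB ->
       incident ends v e1 -> incident ends v e2 ->
       neg_edge_battery (sup_ends ends v e1 e2) (sup_sigma sigma e1 e2)
         (sup_edges FB e1 e2) None (sup_edges C e1 e2))).
Proof.
move=> _ cC vC C1 bB CF; have [wfB cnB ncB _] := bB.
have incv e (D : {set E}) : e \in D -> incident ends v e -> v \in verts ends D.
  by move=> eD ie; apply/vertsP; exists e.
split=> [[_ _ nC uC]|[[_ uB dv] sup]].
  have uFB : unbalanced ends sigma FB by exists C.
  have dv : deg ends FB v = 2%N.
    (* An edge of the block at [v] outside [C] would lie on a negative circle through [v] different
       from [C]. *)
    rewrite (deg_subD ends v CF) (circle_deg cC vC).
    suff -> : deg ends (FB :\: C) v = 0%N by [].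
    apply/eqP; rewrite -leqn0 leqNgt -verts_deg; apply/vertsP=> -[f].
    rewrite inE => /andP[fC fF] iv.
    have [D [cD DF fD nD]] := unbalanced_edge wfB cnB ncB uFB fF.
    by move: fC; rewrite -(uC D cD (incv _ _ fD iv) nD) fD.
  split; first split=> //.
    (* An edge [f] of the other block at [v] lies on a negative circle, which must be [C]; the two
       blocks then share [f]. *)
    move=> W F bl vW uF; have [wf cn nc _] := bl.
    have [D0 [cD0 D0F _]] := uF; have [e0 /(subsetP D0F) e0F] := circle_nonempty cD0.
    have [f fF iv] := connected_edge_at wf cn vW e0F.
    have [D [cD DF fD nD]] := unbalanced_edge wf cn nc uF fF.
    have DC := uC D cD (incv _ _ fD iv) nD; rewrite DC in fD.
    exact: block_shared_edge bB bl (subsetP CF _ fD) fF.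
  move=> e1 e2 ne e1F e2F i1 i2.
  have e1C := circle_uses_edge cC CF vC dv e1F i1.
  have e2C := circle_uses_edge cC CF vC dv e2F i2.
  split.
  - exact: (suppress_circle ne e1F e2F i1 i2 dv cC CF e1C e2C).
  - exact: sup_edges_sub.
  - exact: sup_edges_None.
  - by rewrite /negative csign_suppress.
  - move=> D' cD' sD' ND' nD'.
    have [D [cD DF e1D e2D DE]] :=
      unsuppress_circle ne e1F e2F i1 i2 dv cD' sD' ND'.
    rewrite -DE (uC D cD (incv _ _ e1D i1)) //.
    by move: nD'; rewrite -DE /negative csign_suppress.
have [e1 [e2 [ne e1C e2C i1 i2]]] := circle_two_edges cC vC C1.
have [e1F e2F] := (subsetP CF _ e1C, subsetP CF _ e2C).
have [_ _ _ nC uC] := sup e1 e2 ne e1F e2F i1 i2.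
split=> //; first by move: nC; rewrite /negative csign_suppress.
move=> D cD vD nD.
(* The block around [D] contains [v] and is unbalanced by [D] itself, so (1) identifies it with the
   block of [C], where suppression applies to [D] too. *)
have [W [F [bl sW DF]]] := circle_in_block cD.
have [_ FE] : W = WB /\ F = FB by apply: uB bl (subsetP sW _ vD) _; exists D.
rewrite {}FE in DF.
have e1D := circle_uses_edge cD DF vD dv e1F i1.
have e2D := circle_uses_edge cD DF vD dv e2F i2.
apply: (sup_edges_inj e1D e2D e1C e2C); apply: uC.
- exact: (suppress_circle ne e1F e2F i1 i2 dv cD DF e1D e2D).
- exact: sup_edges_sub.
- exact: sup_edges_None.
- by rewrite /negative csign_suppress.
Qed.
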